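(* Let $N\ge 2$, and let $Q,B$ be real constant $N\times N$ matrices with $Q=Q^\star\ge 0$, such that $K(t)=\frac1t\int_0^t e^{sB}Qe^{sB^\star}ds$ is positive definite for every $t>0$. Let $\mathscr A u=\operatorname{tr}(Q\nabla^2u)+\langle BX,\nabla u\rangle$ be the associated operator on $\mathbb R^N$, with volume function $V(t)$, Besov spaces $\mathfrak B^{\mathscr A}_{2s,1}$, seminorm $\mathscr N^{\mathscr A}_{2s,1}$ and $s$-perimeter $\mathfrak P_{\mathscr A,s}$ as defined in the context. Let $0<s<\frac12$ and assume $\operatorname{tr}B\ge 0$. Suppose there exist $D,\gamma_D>0$ such that $$V(t)\ge \gamma_D\, t^{D/2}\qquad\text{for all } t>0.$$ Then $\mathfrak B^{\mathscr A}_{2s,1}\hookrightarrow L^{\frac{D}{D-2s}}(\mathbb R^N)$. More precisely, there exists a constant $c>0$, depending only on $N,D,s,\gamma_D$, such that for every $f\in\mathfrak B^{\mathscr A}_{2s,1}$ one has $$\|f\|_{L^{\frac{D}{D-2s}}(\mathbb R^N)}\le \frac1c\,\mathscr N^{\mathscr A}_{2s,1}(f).$$ In particular, for any measurable set $E\subset\mathbb R^N$ with $|E|<\infty$, one has $$\mathfrak P_{\mathscr A,s}(E)\ge c\,|E|^{\frac{D-2s}{D}}.$$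
   Context: Lebesgue measure on $\mathbb R^N$ is denoted $|\cdot|$, $\omega_N$ is the Lebesgue measure of the unit ball of $\mathbb R^N$, $L^p=L^p(\mathbb R^N,dX)$, $X$ denotes the generic point of $\mathbb R^N$, and $B^\star$ is the transpose of $B$. Volume function: $V(t)=\omega_N\,(\det(tK(t)))^{1/2}$ for $t>0$. Heat kernel and semigroup: for $X,Y\in\mathbb R^N$ and $t>0$ let $m_t(X,Y)=\sqrt{\langle K(t)^{-1}(Y-e^{tB}X),Y-e^{tB}X\rangle}$ and $$p(X,Y,t)=\frac{\omega_N(4\pi)^{-N/2}}{V(t)}\exp\left(-\frac{m_t(X,Y)^2}{4t}\right),\qquad P_tf(X)=\int_{\mathbb R^N}p(X,Y,t)f(Y)\,dY.$$ Besov space: for $0<\alpha<1$ and $1\le p<\infty$, $\mathfrak B^{\mathscr A}_{\alpha,p}$ is the set of all $f\in L^p$ such that $$\mathscr N^{\mathscr A}_{\alpha,p}(f)=\left(\int_0^\infty\frac{1}{t^{\frac{\alpha p}{2}+1}}\int_{\mathbb R^N}P_t\left(|f-f(X)|^p\right)(X)\,dX\,dt\right)^{1/p}<\infty,$$ where $P_t(|f-f(X)|^p)(X)=\int_{\mathbb R^N}p(X,Y,t)|f(Y)-f(X)|^p\,dY$. $s$-perimeter: for $0<s<\frac12$ and $E\subset\mathbb R^N$ measurable, $E$ has finite $s$-perimeter if $\mathbf 1_E\in\mathfrak B^{\mathscr A}_{2s,1}$, and $\mathfrak P_{\mathscr A,s}(E)=\mathscr N^{\mathscr A}_{2s,1}(\mathbf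 1_E)$, where $\mathbf 1_E$ is the indicator function of $E$. If $|E|<\infty$ and $\mathbf 1_E\notin\mathfrak B^{\mathscr A}_{2s,1}$ then $\mathfrak P_{\mathscr A,s}(E)=\mathscr N^{\mathscr A}_{2s,1}(\mathbf 1_E)=+\infty$. The volume lower bound in the hypothesis forces $D>2s$, so that $\frac{D}{D-2s}>1$. *)

(* Defs.v *)
From HB Require Import structures.
From mathcomp Require Import all_boot all_order all_algebra.
From mathcomp Require Import all_classical all_reals all_analysis.

Set Implicit Arguments.
Unset Strict Implicit.
Unset Printing Implicit Defensive.

Import Order.TTheory GRing.Theory Num.Theory.
Import numFieldNormedType.Exports.

Local Open Scope classical_set_scope.
Local Open Scope ring_scope.

Lemma sigma_finite_measure_of d (T : measurableType d) (R : realType)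
    (nu : set T -> \bar R) :
  nu set0 = 0%E -> (forall A, 0 <= nu A)%E -> semi_sigma_additive nu ->
  sigma_finite setT nu ->
  exists mu : {sigma_finite_measure set T -> \bar R},
    mu = nu :> (set T -> \bar R).
Proof.
move=> nu0 nu_ge0 nu_add nu_fin.
pose nuM := isMeasure.Build _ _ _ nu nu0 nu_ge0 nu_add.
pose nu1 : {measure set T -> \bar R} := HB.pack nu nuM.
pose nuS := Measure_isSigmaFinite.Build _ _ _ nu1 nu_fin.
pose nu2 : {sigma_finite_measure set T -> \bar R} := HB.pack nu nuM nuS.
by exists nu2.
Qed.

(* The library instance making m1 \x m2 sigma-finite is shadowed by the one for
   subprobabilities, so that sigma-finiteness is reproved here. *)
Lemma pushforward_prod_sigma_finite d1 d2 d3 (T1 : measurableType d1)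
    (T2 : measurableType d2) (T3 : measurableType d3) (R : realType)
    (m1 : {sigma_finite_measure set T1 -> \bar R})
    (m2 : {sigma_finite_measure set T2 -> \bar R})
    (f : T1 * T2 -> T3) (g : T3 -> T1 * T2) :
  measurable_fun setT f -> measurable_fun setT g -> cancel f g ->
  exists nu : {sigma_finite_measure set T3 -> \bar R},
    nu = pushforward (product_measure1 m1 m2) f :> (set T3 -> \bar R).
Proof.
move=> mf mg fK.
pose P := product_measure1 m1 m2 : {measure set (T1 * T2)%type -> \bar R}.
pose nu := pushforward P f.
have nu0 : nu set0 = 0%E by rewrite /nu /pushforward preimage_set0 measure0.
have nu_ge0 A : (0 <= nu A)%E by exact: measure_ge0.
have nu_add : semi_sigma_additive nu.
  move=> F mF tF mUF; rewrite /nu /pushforward preimage_bigcup.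
  apply: measure_semi_sigma_additive.
  - by move=> k; rewrite -[X in measurable X]setTI; exact: mf.
  - apply/trivIsetP => i j _ _ ij; rewrite -preimage_setI.
    by move/trivIsetP : tF => /(_ _ _ _ _ ij) ->//; rewrite preimage_set0.
  - by rewrite -preimage_bigcup -[X in measurable X]setTI; exact: mf.
have nu_fin : sigma_finite setT nu.
  have /sigma_finiteP[F [TF ndF Foo]] := sigma_finiteT m1.
  have /sigma_finiteP[G [TG ndG Goo]] := sigma_finiteT m2.
  exists (fun k => g @^-1` (F k `*` G k)).
    rewrite -preimage_bigcup; apply/esym/seteqP; split=> // x _ /=.
    have [n _ Fn] : (\bigcup_k F k) (g x).1 by rewrite -TF.
    have [k _ Gk] : (\bigcup_k G k) (g x).2 by rewrite -TG.
    exists (maxn n k) => //; split.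
    - by move: Fn; apply: (subsetPset _ _ _); exact/ndF/leq_maxl.
    - by move: Gk; apply: (subsetPset _ _ _); exact/ndG/leq_maxr.
  move=> k; have [mF ?] := Foo k; have [mG ?] := Goo k; split.
    by rewrite -[X in measurable X]setTI; apply: mg => //; exact: measurableX.
  rewrite /= /nu /pushforward -comp_preimage (_ : g \o f = id).
    by rewrite [X in (X < _)%E]product_measure1E// lte_mul_pinfty// ge0_fin_numE.
  exact/funext.
exact: sigma_finite_measure_of.
Qed.

Section lebesgue_tuple.
Context {R : realType}.
Local Notation T := (measurableTypeR R).

Definition cons_pair n (z : T * n.-tuple T) : n.+1.-tuple T :=
  [tuple of z.1 :: z.2].

(* The n-fold product of the Lebesgue measure of R, on the Borel sets. *)
Fixpoint lebesgue_tuple n : set (n.-tuple T) -> \bar R :=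
  match n with
  | 0 => \d_ ([tuple] : 0.-tuple T)
  | m.+1 => pushforward
      (product_measure1 lebesgue_measure (@lebesgue_tuple m)) (@cons_pair m)
  end.

Lemma lebesgue_tuple_sigma_finite_measure n :
  exists mu : {sigma_finite_measure set (n.-tuple T) -> \bar R},
    mu = @lebesgue_tuple n :> (set _ -> \bar R).
Proof.
elim: n => [|n [mu muE]]; first by exists (\d_ ([tuple] : 0.-tuple T)).
rewrite [@lebesgue_tuple n.+1]/= -muE.
pose uncons (x : n.+1.-tuple T) : T * n.-tuple T :=
  (thead x, [tuple of behead x]).
apply: (@pushforward_prod_sigma_finite _ _ _ _ _ _ _ _ _ _ uncons).
- exact: measurable_cons.
- apply: measurable_fun_pair; last exact: measurable_behead.
  exact: measurable_tnth.
- by move=> [x y]; congr pair; apply/val_inj.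
Qed.

Let lebesgue_tuple0 n : @lebesgue_tuple n set0 = 0%E.
Proof.
by have [mu <-] := lebesgue_tuple_sigma_finite_measure n; rewrite measure0.
Qed.

Let lebesgue_tuple_ge0 n A : (0 <= @lebesgue_tuple n A)%E.
Proof. by have [mu <-] := lebesgue_tuple_sigma_finite_measure n. Qed.

Let lebesgue_tuple_sigma_additive n : semi_sigma_additive (@lebesgue_tuple n).
Proof.
have [mu <-] := lebesgue_tuple_sigma_finite_measure n.
exact: measure_semi_sigma_additive.
Qed.

HB.instance Definition _ n := isMeasure.Build _ _ _ (@lebesgue_tuple n)
  (@lebesgue_tuple0 n) (@lebesgue_tuple_ge0 n)
  (@lebesgue_tuple_sigma_additive n).

Let lebesgue_tuple_sigma_finite n : sigma_finite setT (@lebesgue_tuple n).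
Proof.
by have [mu <-] := lebesgue_tuple_sigma_finite_measure n; exact: sigma_finiteT.
Qed.

HB.instance Definition _ n := Measure_isSigmaFinite.Build _ _ _
  (@lebesgue_tuple n) (@lebesgue_tuple_sigma_finite n).

End lebesgue_tuple.
Arguments lebesgue_tuple {R} n _.

(* R^N with the sigma-algebra of Lebesgue measurable sets (the completion of
   the Borel one); as a bare type, it is N.-tuple R. *)
Definition euclid (R : realType) (N : nat) :=
  caratheodory_type (mu_ext (@lebesgue_tuple R N)).

HB.instance Definition _ (R : realType) (N : nat) :=
  Measurable.on (euclid R N).

Definition lebesgue_euclid (R : realType) (N : nat) :
    set (euclid R N) -> \bar R :=
  @completed_measure_extension _ _ _ (@lebesgue_tuple R N).
Arguments lebesgue_euclid : clear implicits.

HB.instance Definition _ (R : realType) (N : nat) :=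
  Measure.on (lebesgue_euclid R N).

HB.instance Definition _ (R : realType) (N : nat) :=
  Measure_isSigmaFinite.Build _ _ _ (lebesgue_euclid R N)
    (completed_measure_extension_sigma_finite
      (sigma_finiteT (@lebesgue_tuple R N))).

Definition colvec {R : realType} {N : nat} (X : euclid R N) : 'cV[R]_N :=
  \col_i tnth (X : N.-tuple R) i.

Definition dotcv {R : realType} {N : nat} (u v : 'cV[R]_N) : R :=
  \sum_i u i 0 * v i 0.

Definition posdefmx {R : realType} {N : nat} (A : 'M[R]_N) : Prop :=
  forall x : 'cV[R]_N, x != 0 -> 0 < dotcv (A *m x) x.

Definition possemidefmx {R : realType} {N : nat} (A : 'M[R]_N) : Prop :=
  forall x : 'cV[R]_N, 0 <= dotcv (A *m x) x.

Definition expmx {R : realType} {N : nat} (A : 'M[R]_N) : 'M[R]_N :=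
  limn (series (fun k => (k`!%:R^-1 : R) *: A ^+ k)).

Definition unit_ball_volume (R : realType) (N : nat) : R :=
  fine (lebesgue_euclid R N
    [set X : euclid R N | dotcv (colvec X) (colvec X) < 1]).

Section hormander_operator.
Context {R : realType} {N : nat}.
Variables Q B : 'M[R]_N.

Definition covmx (t : R) : 'M[R]_N :=
  t^-1 *: \matrix_(i, j) \int[lebesgue_measure]_(s in `[0, t])
    ((expmx (s *: B) *m Q *m expmx (s *: B^T)) i j).

Definition volume (t : R) : R :=
  unit_ball_volume R N * Num.sqrt (\det (t *: covmx t)).

Definition pseudodist (t : R) (X Y : euclid R N) : R :=
  let Z := colvec Y - expmx (t *: B) *m colvec X in
  Num.sqrt (dotcv (invmx (covmx t) *m Z) Z).

Definition heat_kernel (X Y : euclid R N) (t : R) : R :=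
  unit_ball_volume R N * (4 * pi) `^ (- (N%:R / 2)) / volume t
  * expR (- (pseudodist t X Y ^+ 2 / (4 * t))).

Local Open Scope ereal_scope.

Definition heat_semigroup (t : R) (f : euclid R N -> R) (X : euclid R N) :
    \bar R :=
  \int[lebesgue_euclid R N]_Y (heat_kernel X Y t * f Y)%:E.

Definition besov_seminorm (alpha p : R) (f : euclid R N -> R) : \bar R :=
  (\int[lebesgue_measure]_(t in `]0%R, +oo[)
     ((t `^ (alpha * p / 2 + 1))^-1%:E *
      \int[lebesgue_euclid R N]_X
        heat_semigroup t (fun Y => `|f Y - f X| `^ p)%R X)) `^ p^-1.

Definition besov_space (alpha p : R) : set (euclid R N -> R) :=
  [set f | f \in Lfun (lebesgue_euclid R N) p%:E /\
           besov_seminorm alpha p f < +oo].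

Definition sperimeter (s : R) (E : set (euclid R N)) : \bar R :=
  besov_seminorm (2 * s) 1 \1_E.

End hormander_operator.

(* Main.v *)
(** Write q = D / (D - 2s).  The kernel has total mass one in Y and, by the
    volume bound, is at most C t^(-D/2).  Let 0 <= g be a truncation of |f|,
    with A = ||g||_q finite.  By Chebyshev's inequality the set where g exceeds
    l(t) = (2C)^(1/q) A t^(-(D - 2s)/2) has measure at most t^(D/2) / (2C), so
    that from every X the kernel leaves at least half of its mass on {g <= l(t)}.
    There |f(Y) - f(X)| >= g(X) / 2 as soon as g(X) >= 2 l(t), hence the double
    integral at time t is at least a quarter of the integral of g over
    {g >= 2 l(t)}.  Integrating against dt / t^(s+1) and exchanging the order of
    integration gives a multiple of A^(1-q) times the integral of g^q, that is, of
    A; removing the truncation is monotone convergence.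

    The mass of the kernel is a Gaussian integral, computed one variable at a time
    by completing the square, the remaining quadratic form being the Schur
    complement. *)
From HB Require Import structures.
Require Import Defs.
From mathcomp Require Import all_boot all_order all_algebra.
From mathcomp Require Import all_classical all_reals all_analysis.
From mathcomp Require Import perm measurable_realfun ring lra.
Import Order.TTheory GRing.Theory Num.Theory.
Import numFieldNormedType.Exports.
Local Open Scope classical_set_scope.
Local Open Scope ring_scope.

Set Implicit Arguments.
Unset Strict Implicit.

(** * Sobolev inequality for Markov kernels with polynomial decay *)

Section ge0_integral_monotone.
Context d (T : measurableType d) (R : realType).
Variable mu : {measure set T -> \bar R}.
Import HBNNSimple.

(* Integrals of nonnegative functions are suprema over simple functions, so
   that, unlike in [ge0_le_integral], no measurability is needed. *)
Lemma ge0_integral_monotone (D : set T) (f g : T -> \bar R) :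
  (forall x, D x -> (0 <= f x)%E) -> (forall x, D x -> (f x <= g x)%E) ->
  (\int[mu]_(x in D) f x <= \int[mu]_(x in D) g x)%E.
Proof.
move=> f0 fg; have g0 x : D x -> (0 <= g x)%E.
  by move=> Dx; rewrite (le_trans (f0 _ Dx))// fg.
rewrite !ge0_integralE//; apply: ereal_sup_le => _ [h hf <-].
exists h => // x; rewrite (le_trans (hf x))//.
by rewrite /patch; case: ifPn => // /set_mem; exact: fg.
Qed.

End ge0_integral_monotone.

Lemma chebyshev_powR d (T : measurableType d) (R : realType)
    (mu : {measure set T -> \bar R}) (g : T -> R) (q l : R) :
  measurable_fun setT g -> 0 < q -> 0 < l ->
  ((l `^ q)%:E * mu (~` [set x | (g x <= l)%R]) <= \int[mu]_x (g x `^ q)%:E)%E.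
Proof.
move=> mg q0 l0.
have mA : measurable [set x | g x <= l].
  by rewrite -[X in measurable X]setTI; exact: measurable_fun_le.
rewrite -integral_cst; last exact: measurableC.
rewrite integral_mkcond; apply: ge0_integral_monotone => x _.
  by rewrite /patch; case: ifPn => // _; rewrite lee_fin powR_ge0.
rewrite /patch; case: ifPn => [/set_mem/= /negP|_]; last first.
  by rewrite lee_fin powR_ge0.
rewrite -ltNge lee_fin => lg.
by rewrite ge0_ler_powR ?nnegrE ?ltW// (lt_trans l0).
Qed.

(** The integrand decreases, so on [a, 2a] it is at least its value at 2a, and that interval has
    length a. *)
Lemma integral_powR_ge (R : realType) (s a : R) : 0 < s -> 0 < a ->
  ((2 `^ (- (s + 1)) * a `^ (- s))%:E
   <= \int[lebesgue_measure]_(t in `[a, +oo[) ((t `^ (s + 1))^-1)%:E)%E.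
Proof.
move=> s0 a0.
have : ((2 `^ (- (s + 1)) * a `^ (- s))%:E <=
   \int[lebesgue_measure]_(t in `[a, (2 * a)%R]) (((2 * a) `^ (s + 1))^-1)%:E)%E.
  rewrite integral_cst//= lebesgue_measure_itv/= lte_fin.
  rewrite [X in if X then _ else _](_ : _ = true); last by lra.
  rewrite -EFinB -EFinM lee_fin powRM ?(ltW a0)//.
  rewrite invfM -!powRN -mulrA ler_pM2l ?powR_gt0 ?ltr0n//.
  have -> : 2 * a - a = a by ring.
  rewrite -{3}(powRr1 (ltW a0)) -powRD ?(gt_eqF a0) ?implybT//.
  by rewrite opprD addrNK.
move=> /le_trans; apply.
rewrite [leLHS]integral_mkcond [leRHS]integral_mkcond.
apply: ge0_integral_monotone => x _; rewrite /patch !mem_setE !in_itv/= ?andbT.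
  by case: ifPn; rewrite // lee_fin invr_ge0 powR_ge0.
case: ifPn => [/andP[ax xa]|_]; last first.
  by case: ifPn; rewrite // lee_fin invr_ge0 powR_ge0.
have x0 : 0 < x by rewrite (lt_le_trans a0).
rewrite ax lee_fin lef_pV2 ?posrE ?powR_gt0//; last by lra.
by rewrite ge0_ler_powR ?nnegrE//; lra.
Qed.

(** The factor 1/4 is half the kernel mass times half the increment, 2^(-(s+1)) comes from
    [integral_powR_ge], and the last power is kappa^(1-q) freed from its dependence on the norm of
    the function. *)
Definition sobolev_cst (R : realType) (C D s : R) : R :=
  4^-1 * 2 `^ (- (s + 1)) *
  (2 * (2 * C) `^ (D / (D - 2 * s))^-1) `^ (1 - D / (D - 2 * s)).

Section sobolev.
Context d (T : measurableType d) (R : realType).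
Variables (mu : {sigma_finite_measure set T -> \bar R}) (k : R -> T -> T -> R).
Variables (C D s : R).
Hypotheses (s0 : 0 < s) (sD : 2 * s < D) (C0 : 0 < C).
Hypothesis k_ge0 : forall (t : R) X Y, 0 < t -> 0 <= k t X Y.
Hypothesis mk : forall (t : R) X, 0 < t -> measurable_fun setT (k t X).
Hypothesis k1 : forall (t : R) X, 0 < t -> (\int[mu]_Y (k t X Y)%:E = 1)%E.
Hypothesis k_le : forall (t : R) X Y, 0 < t -> k t X Y <= C * t `^ (- (D / 2)).

Let q := D / (D - 2 * s).
(** Decay exponent of the level l(t). The identity b q = D/2 matches Chebyshev's inequality with the
    decay of the kernel, and s/b = q - 1 makes the time integral produce the power g^q. *)
Let b := (D - 2 * s) / 2.

Let b0 : 0 < b. Proof. by rewrite divr_gt0// subr_gt0. Qed.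

Let q1 : 1 < q.
Proof. by rewrite /q ltr_pdivlMr ?subr_gt0// mul1r ltrBlDr ltrDl mulr_gt0. Qed.

Let q0 : 0 < q. Proof. exact: lt_trans q1. Qed.

Let bq : b * q = D / 2.
Proof. by rewrite /b /q; field; rewrite subr_eq0 gt_eqF. Qed.

Let sb : s / b = q - 1.
Proof. by rewrite /b /q; field; rewrite subr_eq0 gt_eqF//; lra. Qed.

(** Off [A] the kernel has mass at most C t^(-D/2) times t^(D/2)/(2C), which is 1/2, out of a total
    of one. *)
Lemma kernel_mass_ge (t : R) (X : T) (A : set T) : 0 < t -> measurable A ->
  (mu (~` A) <= (t `^ (D / 2) / (2 * C))%:E)%E ->
  ((2^-1)%:E <= \int[mu]_(Y in A) (k t X Y)%:E)%E.
Proof.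
move=> t0 mA muA.
have mkt : measurable_fun [set: T] (fun Y => (k t X Y)%:E).
  by apply/measurable_EFinP; exact: mk.
have kt0 Y : (0 <= (k t X Y)%:E)%E by rewrite lee_fin k_ge0.
have : (\int[mu]_(Y in A) (k t X Y)%:E +
        \int[mu]_(Y in ~` A) (k t X Y)%:E = 1)%E.
  rewrite -(k1 X t0) -ge0_integral_setU ?setUv//; first exact: measurableC.
  by apply/disj_setPCl.
have : (\int[mu]_(Y in ~` A) (k t X Y)%:E <= (2^-1)%:E)%E.
  apply: (@le_trans _ _ (\int[mu]_(Y in ~` A) (C * t `^ (- (D / 2)))%:E)%E).
    by apply: ge0_integral_monotone => Y _ //; rewrite lee_fin k_le.
  rewrite integral_cst; last exact: measurableC.
  apply: (@le_trans _ _
    ((C * t `^ (- (D / 2)))%:E * (t `^ (D / 2) / (2 * C))%:E)%E).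
    by rewrite lee_pmul2l// lte_fin mulr_gt0// powR_gt0.
  rewrite -EFinM lee_fin powRN le_eqVlt; apply/orP; left; apply/eqP.
  by field; rewrite !gt_eqF// powR_gt0.
have : (0 <= \int[mu]_(Y in ~` A) (k t X Y)%:E)%E by exact: integral_ge0.
have : (0 <= \int[mu]_(Y in A) (k t X Y)%:E)%E by exact: integral_ge0.
case: (\int[mu]_(Y in A) _)%E => [x| |];
  case: (\int[mu]_(Y in ~` A) _)%E => [y| |]//=.
by rewrite !lee_fin => _ _ y2 [xy]; lra.
Qed.

Section truncated.
Variables (f g : T -> R) (a : R).
Hypothesis mg : measurable_fun setT g.
Hypothesis g0 : forall X, 0 <= g X.
Hypothesis gf : forall X Y, g X - g Y <= `|f Y - f X|.
Hypothesis ga : (\int[mu]_X (g X `^ q)%:E = a%:E)%E.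
Hypothesis a0 : 0 < a.

(** With a = A^q, the level is l(t) = (kappa/2) t^(-b), so g(X) >= 2 l(t) reads kappa <= t^b
    g(X). *)
Let kappa := 2 * (2 * C * a) `^ q^-1.

Let kappa0 : 0 < kappa.
Proof. by rewrite /kappa mulr_gt0// powR_gt0// !mulr_gt0. Qed.

Let measure_superlevel (t : R) : 0 < t ->
  (mu (~` [set X | g X <= kappa / 2 * t `^ (- b)])%R <=
   (t `^ (D / 2) / (2 * C))%:E)%E.
Proof.
move=> t0; set l := kappa / 2 * _.
have l0 : 0 < l by rewrite /l mulr_gt0 ?powR_gt0// divr_gt0.
(* For this value of l^q, Chebyshev's bound a / l^q is exactly t^(D/2)/(2C). *)
have lq : l `^ q = 2 * C * a * (t `^ (D / 2))^-1.
  rewrite /l powRM ?powR_ge0//; last by rewrite divr_ge0// ltW.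
  rewrite -(powRrM t) mulNr bq powRN; congr (_ * _).
  rewrite /kappa mulrAC divff// mul1r -powRrM mulVf ?gt_eqF//.
  by rewrite powRr1// !mulr_ge0// ltW.
have := chebyshev_powR mu mg q0 l0; rewrite ga lq.
have lq0 : 0 < 2 * C * a * (t `^ (D / 2))^-1.
  by rewrite !mulr_gt0// invr_gt0 powR_gt0.
rewrite -lee_pdivlMl// => /le_trans; apply.
rewrite -EFinM lee_fin le_eqVlt; apply/orP; left; apply/eqP.
by field; rewrite !gt_eqF// powR_gt0.
Qed.

Let increment_ge (t : R) : 0 < t ->
  (\int[mu]_X (\1_[set X | (kappa <= t `^ b * g X)%R] X * (g X / 4))%:E <=
   \int[mu]_X \int[mu]_Y (k t X Y * `|f Y - f X|)%:E)%E.
Proof.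
move=> t0; apply: ge0_integral_monotone => X _.
  by rewrite lee_fin mulr_ge0// divr_ge0.
rewrite indicE; have [|_] := boolP (_ \in _); last first.
  rewrite mul0r; apply: integral_ge0 => Y _.
  by rewrite lee_fin mulr_ge0// k_ge0.
rewrite mul1r => /set_mem/= kX.
set A := [set Y | g Y <= kappa / 2 * t `^ (- b)].
have mA : measurable A.
  by rewrite -[X in measurable X]setTI; exact: measurable_fun_le.
(* On [A] the increment is at least g(X)/2, because g(Y) <= l(t) <= g(X)/2, and [A] carries at least
   half of the kernel mass. *)
apply: (@le_trans _ _ (\int[mu]_(Y in A) ((g X / 2)%:E * (k t X Y)%:E))%E).
  rewrite ge0_integralZl_EFin//.
  - apply: (@le_trans _ _ ((g X / 2)%:E * (2^-1)%:E)%E).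
      by rewrite -EFinM lee_fin; lra.
    rewrite lee_wpmul2l ?lee_fin ?divr_ge0//; apply: kernel_mass_ge => //.
    exact: measure_superlevel.
  - by move=> Y _; rewrite lee_fin k_ge0.
  - by apply/measurable_EFinP/measurable_funTS; exact: mk.
  - by rewrite divr_ge0.
rewrite integral_mkcond; apply: ge0_integral_monotone => Y _.
  apply: erestrict_ge0 => {}Y _.
  by rewrite -EFinM lee_fin mulr_ge0 ?divr_ge0// k_ge0.
rewrite /patch; case: ifPn => [/set_mem/= AY|_]; last first.
  by rewrite lee_fin mulr_ge0// k_ge0.
rewrite -EFinM lee_fin mulrC ler_wpM2l ?k_ge0//.
apply: le_trans (gf X Y).
have tb : 0 < t `^ b by rewrite powR_gt0.
move: AY; rewrite /A/= powRN mulrAC => AY.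
have : kappa / t `^ b <= g X by rewrite ler_pdivrMr// mulrC.
lra.
Qed.

(** For g(X) > 0 the constraint on t is t >= r = (kappa / g(X))^(1/b). The tail integral from r is
    at least a multiple of r^(-s) = (g(X)/kappa)^(q-1), and the factor g(X) raises the exponent to
    q. *)
Let time_integral_ge (X : T) :
  ((4^-1 * 2 `^ (- (s + 1)) * kappa `^ (1 - q) * g X `^ q)%:E <=
   \int[lebesgue_measure]_t
     (\1_[set t | (0 < t)%R /\ (kappa <= t `^ b * g X)%R] t
      * ((t `^ (s + 1))^-1 * (g X / 4)))%:E)%E.
Proof.
(* At g(X) = 0 the left side vanishes since q > 0; the threshold r below requires g(X) > 0. *)
have [gX0|gX0] := eqVneq (g X) 0.
  rewrite gX0 powR0 ?gt_eqF// mulr0; apply: integral_ge0 => t _.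
  by rewrite lee_fin !mulr_ge0// invr_ge0 powR_ge0.
have {}gX0 : 0 < g X by rewrite lt_neqAle eq_sym gX0 g0.
pose r := (kappa / g X) `^ b^-1.
have r0 : 0 < r by rewrite powR_gt0// divr_gt0.
have rb : r `^ b = kappa / g X.
  by rewrite /r -powRrM mulVf ?gt_eqF// powRr1// divr_ge0// ltW.
have rs : r `^ (- s) = (g X / kappa) `^ (q - 1).
  rewrite /r -powRrM mulrN (mulrC b^-1) sb powRN -[g X / kappa]invf_div.
  by rewrite -(@powR_inv1 _ (kappa / g X)) ?divr_ge0 ?(ltW kappa0)//
    -powRrM mulN1r powRN.
apply: (@le_trans _ _ ((g X / 4)%:E * (2 `^ (- (s + 1)) * r `^ (- s))%:E)%E).
  rewrite -EFinM lee_fin rs powRM ?(ltW gX0) ?invr_ge0 ?(ltW kappa0)//.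
  rewrite -(powR_inv1 (ltW kappa0)) -powRrM mulN1r opprB.
  have -> : g X `^ q = g X `^ (q - 1) * g X.
    rewrite -[X in _ * X](powRr1 (ltW gX0)) -powRD ?subrK//.
    by rewrite (gt_eqF gX0) implybT.
  by rewrite le_eqVlt; apply/orP; left; apply/eqP; ring.
apply: (@le_trans _ _ ((g X / 4)%:E *
    \int[lebesgue_measure]_(t in `[r, +oo[) ((t `^ (s + 1))^-1)%:E)%E).
  by rewrite lee_wpmul2l ?lee_fin ?divr_ge0//; exact: integral_powR_ge.
rewrite -ge0_integralZl_EFin//; first last.
- by rewrite divr_ge0.
- apply/measurable_EFinP/measurable_funTS.
  under eq_fun do rewrite -powRN; exact: measurable_powR.
- by move=> t _; rewrite lee_fin invr_ge0 powR_ge0.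
rewrite integral_mkcond; apply: ge0_integral_monotone => t _.
  apply: erestrict_ge0 => {}t _.
  by rewrite -EFinM lee_fin mulr_ge0 ?divr_ge0// invr_ge0 powR_ge0.
rewrite /patch; case: ifPn => [|_]; last first.
  by rewrite lee_fin !mulr_ge0// invr_ge0 powR_ge0.
rewrite mem_setE in_itv/= andbT => rt.
have t0 : 0 < t by exact: lt_le_trans rt.
rewrite -EFinM lee_fin indicE mem_set ?mul1r 1?mulrC//=; split => //.
rewrite -ler_pdivrMr// -rb ge0_ler_powR ?nnegrE ?(ltW b0) ?(ltW r0) ?(ltW t0)//.
Qed.

Lemma sobolev_truncated :
  ((sobolev_cst C D s * a `^ q^-1)%:E <=
   \int[lebesgue_measure]_(t in `]0%R, +oo[) ((t `^ (s + 1))^-1%:E *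
     \int[mu]_X \int[mu]_Y (k t X Y * `|f Y - f X|)%:E))%E.
Proof.
pose S : set (R * T) := [set z | (0 < z.1)%R /\ (kappa <= z.1 `^ b * g z.2)%R].
pose F (z : R * T) : \bar R :=
  (\1_S z * ((z.1 `^ (s + 1))^-1 * (g z.2 / 4)))%:E.
have F0 z : (0 <= F z)%E.
  by rewrite lee_fin !mulr_ge0// invr_ge0 powR_ge0.
have mg2 : measurable_fun [set: R * T] (fun z => g z.2).
  exact: measurableT_comp.
have mpow p : measurable_fun [set: R * T] (fun z => z.1 `^ p).
  exact: (measurableT_comp (measurable_powR p) measurable_fst).
have mS : measurable S.
  rewrite (_ : S = ~` [set z | (z.1 <= 0)%R] `&`
                   [set z | (kappa <= z.1 `^ b * g z.2)%R]).
    apply: measurableI; [apply: measurableC|];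
      rewrite -[X in measurable X]setTI; apply: measurable_fun_le => //.
    exact: measurable_funM.
  by apply/seteqP; split => z [/= z0 zk]; split => //;
    move: z0; rewrite ltNge => /negP.
have mF : measurable_fun setT F.
  apply/measurable_EFinP; apply: measurable_funM; first exact: measurable_indic.
  apply: measurable_funM; last exact: measurable_funM.
  by under eq_fun do rewrite -powRN; exact: mpow.
apply: (@le_trans _ _ (\int[lebesgue_measure]_t \int[mu]_X F (t, X))%E).
  (* Tonelli is applied to the minorant [F], whose joint measurability in time and space follows
     from that of g. *)
  rewrite [leRHS](fubini_tonelli (m1 := lebesgue_measure) (m2 := mu) F mF F0).
  apply: (@le_trans _ _ (\int[mu]_X
      (4^-1 * 2 `^ (- (s + 1)) * kappa `^ (1 - q) * g X `^ q)%:E)%E).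
    under eq_integral do rewrite EFinM.
    have c0 : 0 <= 4^-1 * 2 `^ (- (s + 1)) * kappa `^ (1 - q).
      by rewrite !mulr_ge0// powR_ge0.
    rewrite [leRHS]ge0_integralZl_EFin//; last 2 first.
    - by move=> X _; rewrite lee_fin powR_ge0.
    - by apply/measurable_EFinP; exact: (measurableT_comp (measurable_powR q) mg).
    (* The factor a^(1/q) of kappa contributes a^((1-q)/q), which times the integral a gives
       a^(1/q). *)
    have kappaE : kappa = 2 * (2 * C) `^ q^-1 * a `^ q^-1.
      by rewrite /kappa (@powRM _ (2 * C)) ?(ltW a0) ?mulr_ge0 ?(ltW C0)// mulrA.
    rewrite ga -EFinM lee_fin /sobolev_cst -/q kappaE.
    rewrite (@powRM _ _ (a `^ q^-1)) ?mulr_ge0 ?powR_ge0// -!mulrA.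
    do 3 rewrite ler_wpM2l ?invr_ge0 ?powR_ge0//.
    rewrite -powRrM -[X in _ * X](powRr1 (ltW a0)) -powRD ?(gt_eqF a0) ?implybT//.
    by rewrite mulrBr mulr1 mulVf ?subrK// gt_eqF.
  apply: ge0_integral_monotone => X _.
    by rewrite lee_fin !mulr_ge0// powR_ge0.
  apply: le_trans (time_integral_ge X) _; rewrite le_eqVlt; apply/orP; left.
  by apply/eqP; apply: eq_integral => t _; rewrite /F !indicE.
rewrite [leRHS]integral_mkcond; apply: ge0_integral_monotone => t _.
  exact: integral_ge0.
rewrite /patch mem_setE in_itv/= andbT; case: ifPn => [t0|/negP t0]; last first.
  rewrite integral0_eq// => X _; rewrite /F indicE memNset ?mul0r//.
  by move=> [].
apply: (@le_trans _ _ ((t `^ (s + 1))^-1%:E * \int[mu]_X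
  (\1_[set X | (kappa <= t `^ b * g X)%R] X * (g X / 4))%:E)%E); last first.
  by rewrite lee_wpmul2l ?lee_fin ?invr_ge0 ?powR_ge0//; exact: increment_ge.
have mS' : measurable [set X | (kappa <= t `^ b * g X)%R].
  rewrite -[X in measurable X]setTI; apply: measurable_fun_le => //.
  exact: measurable_funM.
rewrite -ge0_integralZl_EFin//; first last.
- by rewrite invr_ge0 powR_ge0.
- apply/measurable_EFinP; apply: measurable_funM; first exact: measurable_indic.
  exact: measurable_funM.
- by move=> X _; rewrite lee_fin mulr_ge0// divr_ge0.
rewrite le_eqVlt; apply/orP; left; apply/eqP; apply: eq_integral => X _.
rewrite /F -EFinM !indicE; congr EFin; rewrite [RHS]mulrCA.
congr ((nat_of_bool _)%:R * _).
by apply/idP/idP => /set_mem/= kX; apply/mem_set => //=; case: kX.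
Qed.

End truncated.

Lemma sobolev_cst_gt0 : 0 < sobolev_cst C D s.
Proof. by rewrite !mulr_gt0 ?powR_gt0// mulr_gt0 ?powR_gt0// mulr_gt0. Qed.

Lemma sobolev_inequality (f : T -> R) :
  measurable_fun [set: T] f -> (\int[mu]_X `|f X|%:E < +oo)%E ->
  ((sobolev_cst C D s)%:E * Lnorm mu q%:E (EFin \o f) <=
   \int[lebesgue_measure]_(t in `]0%R, +oo[) ((t `^ (s + 1))^-1%:E *
     \int[mu]_X \int[mu]_Y (k t X Y * `|f Y - f X|)%:E))%E.
Proof.
move=> mf f1; set N := (\int[_]_(t in _) _)%E.
have c0 := sobolev_cst_gt0; set c := sobolev_cst C D s in c0 *.
have N0 : (0 <= N)%E.
  apply: integral_ge0 => t; rewrite /= in_itv/= andbT => t0.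
  rewrite mule_ge0 ?lee_fin ?invr_ge0 ?powR_ge0//.
  apply: integral_ge0 => X _; apply: integral_ge0 => Y _.
  by rewrite lee_fin mulr_ge0// k_ge0.
have [->|NNy] := eqVneq N +oo%E; first by rewrite leey.
pose M := fine N; have NE : N = M%:E by rewrite fineK// ge0_fin_numE// ltey.
have M0 : 0 <= M by rewrite fine_ge0.
pose g n X := Num.min `|f X| n%:R.
have g0 n X : 0 <= g n X by rewrite le_min normr_ge0 ler0n.
have mg n : measurable_fun [set: T] (g n).
  by apply: measurable_minr => //; exact: measurableT_comp.
have mgq n : measurable_fun [set: T] (fun X => (g n X `^ q)%:E).
  apply/measurable_EFinP; exact: (measurableT_comp (measurable_powR q) (mg n)).
have gq_fin n : (\int[mu]_X (g n X `^ q)%:E < +oo)%E.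
  (* Since g_n is at most n and at most |f|, its power g_n^q is at most n^(q-1) |f|. This is where
     the integrability of f enters. *)
  apply: (@le_lt_trans _ _ (\int[mu]_X ((n%:R `^ (q - 1))%:E * `|f X|%:E))%E).
    apply: ge0_integral_monotone => X _; first by rewrite lee_fin powR_ge0.
    rewrite -EFinM lee_fin.
    have [->|gX0] := eqVneq (g n X) 0.
      by rewrite powR0 ?gt_eqF// mulr_ge0 ?powR_ge0.
    rewrite -{1}(subrK 1 q) powRD ?gX0 ?implybT// powRr1//.
    rewrite ler_pM ?powR_ge0// ?ge_min ?lexx//.
    by rewrite ge0_ler_powR ?nnegrE ?ler0n ?ge_min ?lexx ?orbT// subr_ge0 ltW.
  rewrite ge0_integralZl_EFin ?powR_ge0//; last first.
    by apply/measurable_EFinP; exact: measurableT_comp.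
  by rewrite lte_mul_pinfty// lee_fin powR_ge0.
have gq_le n : (\int[mu]_X (g n X `^ q)%:E <= ((M / c) `^ q)%:E)%E.
  have gq_ge0 : (0 <= \int[mu]_X (g n X `^ q)%:E)%E.
    by apply: integral_ge0 => X _; rewrite lee_fin powR_ge0.
  pose a := fine (\int[mu]_X (g n X `^ q)%:E)%E.
  have aE : (\int[mu]_X (g n X `^ q)%:E = a%:E)%E.
    by rewrite fineK// ge0_fin_numE.
  (* The truncated estimate requires a > 0; at a = 0 the bound is immediate. *)
  rewrite aE lee_fin; have [->|a_neq0] := eqVneq a 0; first by rewrite powR_ge0.
  have a0 : 0 < a by rewrite lt_neqAle eq_sym a_neq0 fine_ge0.
  (* The absolute value and the minimum with n are both 1-Lipschitz. *)
  have gf X Y : g n X - g n Y <= `|f Y - f X|.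
    have fXY : `|f X| <= `|f Y| + `|f Y - f X|.
      by rewrite -lerBlDl distrC; exact: lerB_dist.
    have := normr_ge0 (f Y - f X).
    by rewrite /g; case: (leP `|f X|) => ?; case: (leP `|f Y|) => ?; lra.
  have := sobolev_truncated (mg n) (g0 n) gf aE a0.
  rewrite -/N NE lee_fin mulrC -ler_pdivlMr// => aM.
  rewrite -(powRr1 (ltW a0)) -(@mulVf _ q) ?gt_eqF// powRrM.
  by rewrite ge0_ler_powR ?(ltW q0)// nnegrE ?powR_ge0// divr_ge0// ltW.
have fq_le : (\int[mu]_X (`|f X| `^ q)%:E <= ((M / c) `^ q)%:E)%E.
  have -> : (\int[mu]_X (`|f X| `^ q)%:E =
      limn (fun n => \int[mu]_X (g n X `^ q)%:E))%E.
    rewrite -monotone_convergence//; last 2 first.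
    - by move=> n X _; rewrite lee_fin powR_ge0.
    - move=> X _ m n mn; rewrite lee_fin ge0_ler_powR ?nnegrE ?(ltW q0)//.
      by rewrite /g le_min ge_min lexx/= ge_min ler_nat mn orbT.
    (* Once n >= |f(X)| the truncation is inactive, so the sequence is eventually constant. *)
    apply: eq_integral => X _; apply/esym/lim_near_cst => //.
    near=> n; rewrite /g min_l//.
    by near: n; exact: nbhs_infty_ger.
  apply: lime_le; last by apply: nearW => n; exact: gq_le.
  apply: ereal_nondecreasing_is_cvgn => m n mn.
  apply: ge0_integral_monotone => X _; rewrite lee_fin ?powR_ge0//.
  rewrite ge0_ler_powR ?nnegrE ?(ltW q0)//.
  by rewrite /g le_min ge_min lexx/= ge_min ler_nat mn orbT.
have -> : Lnorm mu q%:E (EFin \o f) = ((\int[mu]_X (`|f X| `^ q)%:E) `^ q^-1)%E.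
  by rewrite unlock.
have fq0 : (0 <= \int[mu]_X (`|f X| `^ q)%:E)%E.
  by apply: integral_ge0 => X _; rewrite lee_fin powR_ge0.
have : ((\int[mu]_X (`|f X| `^ q)%:E) `^ q^-1 <= ((M / c) `^ q)%:E `^ q^-1)%E.
  apply: gt0_ler_poweR => //; rewrite ?invr_ge0 ?(ltW q0)// in_itv/= leey andbT//.
  by rewrite lee_fin powR_ge0.
rewrite poweR_EFin -powRrM divff ?gt_eqF// powRr1 ?divr_ge0 ?(ltW c0)//.
rewrite NE => le_fM.
apply: (@le_trans _ _ (c%:E * (M / c)%:E)%E); last first.
  by rewrite -EFinM lee_fin mulrC divfK ?gt_eqF.
by rewrite lee_wpmul2l// lee_fin ltW.
Unshelve. all: by end_near. Qed.

End sobolev.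

(** * Matrix exponential and covariance matrices *)

Section matrix_norm.
Context {R : realType} {N : nat}.
Implicit Types A B : 'M[R]_N.

Lemma mx_norm_geP m n (A : 'M[R]_(m, n)) (c : R) : 0 <= c ->
  `|A| <= c <-> forall i j, `|A i j| <= c.
Proof.
move=> c0; rewrite /Num.Def.normr/= mx_normrE; split=> [Ac i j|Ac].
  by apply: le_trans Ac; exact: (le_bigmax _ (fun ij => `|A ij.1 ij.2|) (i, j)).
by apply: bigmax_le => //= -[i j] _; exact: Ac.
Qed.

Lemma ler_entry_norm m n (A : 'M[R]_(m, n)) i j : `|A i j| <= `|A|.
Proof. by move: i j; apply/mx_norm_geP. Qed.

Lemma mx_norm_tr A : `|A^T| = `|A|.
Proof.
apply/eqP; rewrite eq_le; apply/andP; split; apply/mx_norm_geP => // i j.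
  by rewrite mxE ler_entry_norm.
by have := ler_entry_norm A^T j i; rewrite mxE.
Qed.

(** The norm is the largest absolute value of an entry, and an entry of the product is a sum of N
    terms; hence the factor N. *)
Lemma mx_norm_mul A B : `|A *m B| <= N%:R * `|A| * `|B|.
Proof.
apply/mx_norm_geP => [|i j]; first by rewrite !mulr_ge0.
rewrite mxE (le_trans (ler_norm_sum _ _ _))//.
apply: (@le_trans _ _ (\sum_(k < N) `|A| * `|B|)).
  by apply: ler_sum => k _; rewrite normrM ler_pM// ler_entry_norm.
by rewrite sumr_const card_ord -[leLHS]mulr_natl mulrA.
Qed.

Lemma mx_norm_exp A n : `|A ^+ n| <= (N%:R * `|A|) ^+ n.
Proof.
elim: n => [|n IHn].
  rewrite !expr0; apply/mx_norm_geP => // i j; rewrite mxE.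
  by case: (_ == _); rewrite ?normr1 ?normr0.
rewrite exprS (le_trans (mx_norm_mul _ _))// exprS ler_wpM2l//.
Qed.

Lemma ler_norm_det A (c : R) : 0 <= c -> (forall i j, `|A i j| <= c) ->
  `|\det A| <= N`!%:R * c ^+ N.
Proof.
move=> c0 Ac; rewrite /determinant (le_trans (ler_norm_sum _ _ _))//.
apply: (@le_trans _ _ (\sum_(s : 'S_N) c ^+ N)); last first.
  by rewrite sumr_const card_Sn mulr_natl.
apply: ler_sum => s _; rewrite normrM normrX normrN1 expr1n mul1r normr_prod.
apply: (@le_trans _ _ (\prod_(i < N) c)).
  by apply: ler_prod => i _; rewrite normr_ge0 Ac.
by rewrite prodr_const card_ord.
Qed.

End matrix_norm.

HB.instance Definition _ (R : realType) (m n : nat) := Complete.on 'M[R]_(m, n).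

Section matrix_exponential.
Context {R : realType} {N : nat}.
Implicit Types A B : 'M[R]_N.

Let coeff A : nat -> 'M[R]_N := fun k => (k`!%:R^-1 : R) *: A ^+ k.

(** Domination by the scalar exponential series gives both the convergence and the norm bound for
    [expmx]; the factor N is that of [mx_norm_mul]. *)
Let coeff_le A k : `|coeff A k| <= exp_coeff (N%:R * `|A|) k.
Proof.
rewrite /coeff normrZ /exp_coeff/= mulrC ger0_norm ?invr_ge0//.
by rewrite ler_wpM2r ?invr_ge0// mx_norm_exp.
Qed.

Let is_cvg_normed_coeff A : cvgn [normed series (coeff A)].
Proof.
apply: (@series_le_cvg _ _ (exp_coeff (N%:R * `|A|))) => [n|n|n|].
- exact: normr_ge0.
- by rewrite exp_coeff_ge0// mulr_ge0.
- exact: coeff_le.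
- exact: is_cvg_series_exp_coeff.
Qed.

Lemma is_cvg_series_expmx A :
  cvgn (series (fun k => (k`!%:R^-1 : R) *: A ^+ k)).
Proof. by apply: normed_cvg; exact: is_cvg_normed_coeff. Qed.

Lemma expmx_norm_le A : `|expmx A| <= expR (N%:R * `|A|).
Proof.
rewrite /expmx (le_trans (lim_series_norm (@is_cvg_normed_coeff A)))//.
apply: ler_lim; [exact: is_cvg_normed_coeff|exact: is_cvg_series_exp_coeff|].
by apply: nearW => n; apply: ler_sum => k _; exact: coeff_le.
Qed.

Lemma trmx_exp A n : (A ^+ n)^T = A^T ^+ n.
Proof.
elim: n => [|n IHn]; first by rewrite !expr0 trmx1.
by rewrite exprS exprSr -IHn; exact: trmx_mul.
Qed.

(** Transposition is an isometry that commutes with the partial sums, hence with their limit. *)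
Lemma expmx_tr A : expmx A^T = (expmx A)^T.
Proof.
apply: cvg_lim => //; apply/cvgrPdist_le => e e0.
have /cvgrPdist_le/(_ _ e0) := @is_cvg_series_expmx A.
apply: filterS => n; apply: le_trans.
rewrite -[leRHS]mx_norm_tr linearB/= le_eqVlt; apply/orP; left; apply/eqP.
congr (`| _ - _ |); rewrite /series/= linear_sum/=; apply: eq_bigr => k _.
by rewrite linearZ/= trmx_exp.
Qed.

End matrix_exponential.

(** [f] is not assumed measurable: its positive and negative parts are bounded separately by
    monotonicity, and the factor 2 covers their difference. *)
Lemma Rintegral_norm_le d (T : measurableType d) (R : realType)
    (mu : {measure set T -> \bar R}) (E : set T) (f : T -> R) (c m : R) :
  measurable E -> (mu E = m%:E)%E -> (forall x, E x -> `|f x| <= c) ->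
  0 <= c -> `|Rintegral mu E f| <= 2 * (c * m).
Proof.
move=> mE muE fc c0.
have le_cm (g : T -> \bar R) : (forall x, 0 <= g x)%E ->
    (forall x, E x -> (g x <= c%:E)%E) ->
    (0 <= \int[mu]_(x in E) g x <= (c * m)%:E)%E.
  move=> g0 gc; rewrite integral_ge0//= EFinM -muE -integral_cst//.
  exact: ge0_integral_monotone.
have /andP[p0 pc] : (0 <= \int[mu]_(x in E) (EFin \o f)^\+ x <= (c * m)%:E)%E.
  apply: le_cm => // x Ex; rewrite funepos.unlock/= ge_max !lee_fin c0 andbT.
  exact: le_trans (ler_norm _) (fc _ Ex).
have /andP[n0 nc] : (0 <= \int[mu]_(x in E) (EFin \o f)^\- x <= (c * m)%:E)%E.
  apply: le_cm => // x Ex; rewrite funeneg.unlock/= ge_max !lee_fin c0 andbT.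
  by apply: le_trans (fc _ Ex); rewrite -normrN ler_norm.
rewrite /Rintegral integralE; move: p0 pc n0 nc.
case: (\int[mu]_(x in E) _^\+ x)%E => [p| |]//.
case: (\int[mu]_(x in E) _^\- x)%E => [n| |]//=.
by rewrite !lee_fin ler_norml => p0 pc n0 nc; apply/andP; split; lra.
Qed.

(** * Symmetry and small-time size of the covariance matrices *)

Section covariance.
Context {R : realType} {N : nat}.
Variables Q B : 'M[R]_N.

Lemma covmx_tr (t : R) : Q^T = Q -> (covmx Q B t)^T = covmx Q B t.
Proof.
move=> QT; rewrite /covmx linearZ/=; congr (_ *: _); apply/matrixP => i j.
rewrite !mxE; congr Rintegral; apply/funext => r.
rewrite -[in RHS](trmxK (_ *m _)) [in RHS]mxE !trmx_mul QT -!expmx_tr.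
by rewrite !linearZ/= trmxK mulmxA.
Qed.

(** For t <= 1 the integrand on [0, t] is bounded uniformly, both exponentials having norm at most
    [e]; the interval contributes the factor t. *)
Lemma scaled_covmx_entry_le : exists2 c : R, 0 <= c &
  forall t : R, 0 < t -> t <= 1 -> forall i j, `|(t *: covmx Q B t) i j| <= c * t.
Proof.
pose e := expR (N%:R * `|B|).
pose c := N%:R * (N%:R * e * `|Q|) * e.
have e0 : 0 <= e by exact: expR_ge0.
have c0 : 0 <= c by rewrite !mulr_ge0.
exists (2 * c); first by rewrite mulr_ge0.
move=> t t0 t1 i j; rewrite /covmx scalerA divff ?gt_eqF// scale1r mxE -mulrA.
apply: Rintegral_norm_le => //.
  rewrite [LHS](lebesgue_measure_itv `[0%R, t])/= lte_fin t0.
  by rewrite oppr0 adde0.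
move=> r /=; rewrite in_itv/= => /andP[r0 rt].
have e_le (A : 'M[R]_N) : `|A| = `|B| -> `|expmx (r *: A)| <= e.
  move=> AB; rewrite (le_trans (expmx_norm_le _))// ler_expR ler_wpM2l//.
  by rewrite normrZ AB ger0_norm// ler_piMl// (le_trans rt).
rewrite (le_trans (ler_entry_norm _ _ _))// (le_trans (mx_norm_mul _ _))//.
rewrite ler_pM ?mulr_ge0 ?e_le ?mx_norm_tr// ler_wpM2l//.
by rewrite (le_trans (mx_norm_mul _ _))// ler_wpM2r// ler_wpM2l// e_le.
Qed.

(* The determinant of [t *: covmx Q B t] is O(t ^ N) at 0, which forces the
   volume exponent D to be at least N. *)
Lemma volume_exponent_gt (D s gammaD : R) : (2 <= N)%N -> s < 1 / 2 ->
  0 < gammaD -> (forall t : R, 0 < t -> gammaD * t `^ (D / 2) <= volume Q B t) ->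
  2 * s < D.
Proof.
move=> N2 s2 gamma0 volD; rewrite ltNge; apply/negP => Ds.
have [c c0 covc] := scaled_covmx_entry_le.
(* The determinant bound gives V(t) <= W t^(N/2), hence V(t) <= W t for t <= 1 since N >= 2. *)
pose W := unit_ball_volume R N * Num.sqrt (N`!%:R * c ^+ N).
have ball0 : 0 <= unit_ball_volume R N by exact: fine_ge0.
have W0 : 0 <= W by rewrite mulr_ge0 ?sqrtr_ge0.
(* At t = u^2 the volume is at most W u^2 < [gammaD] u, whereas D <= 2s < 1 would make the lower
   bound [gammaD] u^D at least [gammaD] u. *)
have [u [u0 u1 Wu]] : exists u : R, [/\ 0 < u, u <= 1 & W * u < gammaD].
  have den0 : 0 < gammaD + W + 1 by lra.
  exists (gammaD / (gammaD + W + 1)); split; first by rewrite divr_gt0.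
    by rewrite ler_pdivrMr//; lra.
  by rewrite mulrA ltr_pdivrMr// mulrC ltr_pM2l//; lra.
have uu0 : 0 < u ^+ 2 by rewrite exprn_gt0.
have uu1 : u ^+ 2 <= 1 by rewrite exprn_ile1// ltW.
have := volD _ uu0; apply/negP; rewrite -ltNge.
apply: (@le_lt_trans _ _ (W * u ^+ 2)).
  rewrite /volume /W -mulrA ler_wpM2l//.
  have -> : Num.sqrt (N`!%:R * c ^+ N) * u ^+ 2 =
      Num.sqrt (N`!%:R * c ^+ N * (u ^+ 2) ^+ 2).
    by rewrite [RHS]sqrtrM ?mulr_ge0 ?exprn_ge0// sqrtr_sqr ger0_norm// ltW.
  apply: ler_wsqrtr; rewrite (le_trans (ler_norm _))//.
  rewrite (le_trans (ler_norm_det _ (covc _ uu0 uu1)))//.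
    by rewrite mulr_ge0// ltW.
  rewrite exprMn mulrA ler_wpM2l ?mulr_ge0 ?exprn_ge0//.
  by rewrite ler_wiXn2l ?(ltW uu0).
apply: (@lt_le_trans _ _ (gammaD * u)).
  by rewrite expr2 mulrA ltr_pM2r.
rewrite ler_pM2l// -powR_mulrn ?(ltW u0)// -powRrM.
rewrite -{1}(powRr1 (ltW u0)) mulrC divfK//.
by rewrite ger_powR ?u0//; lra.
Qed.

End covariance.

(** * Gaussian integrals *)

Section dotcv.
Context {R : realType}.

Lemma dotcvC n (u v : 'cV[R]_n) : dotcv u v = dotcv v u.
Proof. by apply: eq_bigr => i _; rewrite mulrC. Qed.

Lemma dotcvDl n (u v w : 'cV[R]_n) : dotcv (u + v) w = dotcv u w + dotcv v w.
Proof.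
by rewrite /dotcv -big_split/=; apply: eq_bigr => i _; rewrite mxE mulrDl.
Qed.

Lemma dotcvZl n (a : R) (u v : 'cV[R]_n) : dotcv (a *: u) v = a * dotcv u v.
Proof.
by rewrite /dotcv mulr_sumr; apply: eq_bigr => i _; rewrite mxE mulrA.
Qed.

Lemma dotcv0l n (v : 'cV[R]_n) : dotcv 0 v = 0.
Proof. by rewrite -(scale0r v) dotcvZl mul0r. Qed.

Lemma dotcv_col_mx m n (u1 u2 : 'cV[R]_m) (v1 v2 : 'cV[R]_n) :
  dotcv (col_mx u1 v1) (col_mx u2 v2) = dotcv u1 u2 + dotcv v1 v2.
Proof.
rewrite /dotcv big_split_ord/=; congr (_ + _); apply: eq_bigr => i _.
  by rewrite !col_mxEu.
by rewrite !col_mxEd.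
Qed.

Lemma dotcv_tr_mull m n (A : 'M[R]_(m, n)) (u : 'cV[R]_m) (v : 'cV[R]_n) :
  dotcv (A^T *m u) v = dotcv u (A *m v).
Proof.
rewrite /dotcv; under eq_bigr do rewrite mxE mulr_suml.
rewrite exchange_big/=; apply: eq_bigr => i _.
by rewrite mxE mulr_sumr; apply: eq_bigr => j _; rewrite mxE; ring.
Qed.

Lemma dotcv_scalar (x y : R) : dotcv (x%:M : 'cV[R]_1) y%:M = x * y.
Proof. by rewrite /dotcv big_ord1 !mxE eqxx !mulr1n. Qed.

End dotcv.

(** * Completing the square by the Schur complement *)

Section schur.
Context {R : realType} {n : nat}.
Variable M : 'M[R]_(1 + n).
Hypotheses (symM : M^T = M) (posM : posdefmx M).

Let a : R := M 0 0.
Let b : 'M[R]_(1, n) := ursubmx M.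
Let d : 'M[R]_n := drsubmx M.

Definition schur : 'M[R]_n := d - a^-1 *: (b^T *m b).

Let MblockE : M = block_mx a%:M b b^T d.
Proof.
rewrite -[LHS]submxK [ulsubmx M]mx11_scalar; congr block_mx.
  by congr (_%:M); rewrite !mxE; congr (M _ _); apply/val_inj.
by rewrite /b -[in RHS]symM -trmx_dlsub trmxK.
Qed.

Lemma schur_pivot_gt0 : 0 < M 0 0.
Proof.
pose e : 'cV[R]_(1 + n) := col_mx 1%:M 0.
have e0 : e != 0.
  apply/eqP => /(congr1 (fun A => usubmx A 0 0)).
  by rewrite col_mxKu !mxE eqxx => /eqP; rewrite oner_eq0.
have := posM e0; rewrite MblockE mul_block_col !mulmx0 !addr0 dotcv_col_mx.
rewrite mulmx1 dotcv_scalar mulr1 -[X in _ + X](_ : 0 = _) ?addr0//.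
  by rewrite -MblockE.
by rewrite /dotcv big1// => i _; rewrite [X in _ * X]mxE mulr0.
Qed.

(** By symmetry both cross terms equal x times b z. Completing the square in x leaves -(b z)^2 / a,
    which is the correction in [schur]. *)
Lemma schur_quad (x : R) (z : 'cV[R]_n) :
  dotcv (M *m col_mx x%:M z) (col_mx x%:M z) =
  M 0 0 * (x + (M 0 0)^-1 * (ursubmx M *m z) 0 0) ^+ 2 + dotcv (schur *m z) z.
Proof.
rewrite -/a -/b; have a0 : a != 0 by rewrite gt_eqF// schur_pivot_gt0.
rewrite [in LHS]MblockE mul_block_col dotcv_col_mx !dotcvDl dotcv_tr_mull.
pose y : R := (b *m z) 0 0; have bz : b *m z = y%:M by exact: mx11_scalar.
rewrite /schur mulmxBl dotcvDl -scaleN1r dotcvZl -scalemxAl dotcvZl -mulmxA.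
rewrite dotcv_tr_mull bz -scalar_mxM !dotcv_scalar !mxE eqxx mulr1n.
by field; exact: a0.
Qed.

Lemma schur_tr : schur^T = schur.
Proof.
rewrite /schur linearB/= linearZ/= trmx_mul trmxK; congr (_ - _).
by rewrite /d trmx_drsub symM.
Qed.

(** The first coordinate x is chosen to cancel the square in [schur_quad], so that the form of M at
    (x, z) is that of [schur] at z. *)
Lemma schur_posdef : posdefmx schur.
Proof.
move=> z z0; pose x := - ((M 0 0)^-1 * (ursubmx M *m z) 0 0).
have := posM (x := col_mx x%:M z); rewrite schur_quad addNr expr0n mulr0 add0r.
by apply; apply: contra z0; rewrite col_mx_eq0 => /andP[].
Qed.

(** M factors into a unit lower triangular block matrix and an upper triangular one with diagonal
    blocks a and [schur]. *)
Lemma schur_det : \det M = M 0 0 * \det schur.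
Proof.
have a0 : a != 0 by rewrite gt_eqF// schur_pivot_gt0.
have ME : M = block_mx 1%:M 0 (a^-1 *: b^T) 1%:M *m block_mx a%:M b 0 schur.
  rewrite mulmx_block !mul1mx !mul0mx !addr0 {1}MblockE; congr block_mx.
    by rewrite -scalemxAl mul_mx_scalar scalerA mulVf// scale1r.
  by rewrite -scalemxAl /schur addrC subrK.
by rewrite [in LHS]ME det_mulmx det_lblock det_ublock !det1 !mul1r det_scalar1.
Qed.

End schur.

(** The integrand is a multiple of the normal density of mean m and variance 2/a, whose mass is
    one. *)
Lemma integral_gaussian (R : realType) (a m : R) : 0 < a ->
  (\int[lebesgue_measure]_x (expR (- (a * (x - m) ^+ 2 / 4)))%:E =
   ((4 * pi) `^ (1 / 2) * (Num.sqrt a)^-1)%:E)%E.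
Proof.
move=> a0; pose sigma := Num.sqrt (2 / a).
have sigma2 : sigma ^+ 2 = 2 / a by rewrite sqr_sqrtr// divr_ge0// ltW.
have sigma0 : sigma != 0 by rewrite gt_eqF// sqrtr_gt0 divr_gt0.
have c0 : 0 <= (4 * pi) `^ (1 / 2) * (Num.sqrt a)^-1 :> R.
  by rewrite mulr_ge0 ?powR_ge0 ?invr_ge0 ?sqrtr_ge0.
transitivity (((4 * pi) `^ (1 / 2) * (Num.sqrt a)^-1)%:E *
  \int[lebesgue_measure]_x (normal_pdf m sigma x)%:E)%E; last first.
  by rewrite integral_normal_pdf mule1.
rewrite -ge0_integralZl_EFin//; last 2 first.
- by move=> x _; rewrite lee_fin normal_pdf_ge0.
- by apply/measurable_EFinP; exact: measurable_normal_pdf.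
apply: eq_integral => x _; rewrite -EFinM normal_pdfE//; congr EFin.
rewrite /normal_peak /normal_fun sigma2.
have -> : (4 * pi) `^ (1 / 2) * (Num.sqrt a)^-1 = Num.sqrt (2 / a * pi *+ 2).
  rewrite (_ : 1 / 2 = 2^-1) ?div1r// powR12_sqrt ?mulr_ge0 ?pi_ge0//.
  rewrite -sqrtrV ?ltW// -sqrtrM ?mulr_ge0 ?pi_ge0//.
  by congr Num.sqrt; rewrite mulr2n; field; rewrite gt_eqF.
rewrite [RHS]mulrA divff ?mul1r; last first.
  by rewrite gt_eqF// sqrtr_gt0 mulrn_wgt0// mulr_gt0 ?pi_gt0// divr_gt0.
by congr expR; rewrite mulr2n; field; rewrite gt_eqF.
Qed.

(** * Gaussian integrals in several variables *)

Section gaussian.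
Context {R : realType}.
Local Notation T := (measurableTypeR R).

(** Normalized so that the exponential in the heat kernel is the case where M is the inverse of t
    K(t) and [w] is the transported point e^(tB) X. *)
Definition gaussian n (M : 'M[R]_n) (w : 'cV[R]_n) (y : n.-tuple T) : R :=
  let z := \col_i tnth y i - w in expR (- (dotcv (M *m z) z / 4)).

Lemma gaussian_gt0 n (M : 'M[R]_n) w y : 0 < gaussian M w y.
Proof. exact: expR_gt0. Qed.

Lemma measurable_gaussian n (M : 'M[R]_n) (w : 'cV[R]_n) :
  measurable_fun [set: n.-tuple T] (gaussian M w).
Proof.
rewrite /gaussian/=; apply: measurableT_comp => //.
apply: measurableT_comp => //; apply: measurable_funM => //.
have mz i : measurable_fun [set: n.-tuple T]
    (fun y => (\col_i tnth y i - w) i 0).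
  under eq_fun do rewrite !mxE.
  by apply: measurable_funD => //; exact: measurable_tnth.
apply: measurable_sum => i; apply: measurable_funM => //.
under eq_fun do rewrite mxE; apply: measurable_sum => j.
by apply: measurable_funM.
Qed.

Lemma gaussian_cons n (M : 'M[R]_n.+1) (w : 'cV[R]_n.+1) (x : T)
    (y : n.-tuple T) :
  M^T = M -> posdefmx M ->
  let z := \col_i tnth y i - dsubmx (w : 'cV[R]_(1 + n)) in
  let m := w 0 0 - (M 0 0)^-1 * (ursubmx (M : 'M[R]_(1 + n)) *m z) 0 0 in
  gaussian M w (cons_pair (x, y)) =
  expR (- (M 0 0 * (x - m) ^+ 2 / 4))
  * gaussian (schur (M : 'M[R]_(1 + n))) (dsubmx (w : 'cV[R]_(1 + n))) y.
Proof.
move=> symM posM z m; rewrite /gaussian/= -/z.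
have -> : \col_i tnth (cons_pair (x, y)) i - w = col_mx (x - w 0 0)%:M z.
  apply/colP => i; case: (split_ordP (i : 'I_(1 + n))) => k ->.
    rewrite [RHS]col_mxEu !mxE (ord1 k)/= mulr1n.
    by congr (_ - w _ _); apply/val_inj.
  rewrite [RHS]col_mxEd !mxE; congr (_ - w _ _).
  by rewrite !(tnth_nth 0).
by rewrite -expRD schur_quad// /m; congr expR; ring.
Qed.

Lemma integral_lebesgue_tupleS n (f : n.+1.-tuple T -> \bar R) :
  measurable_fun [set: n.+1.-tuple T] f -> (forall y, (0 <= f y)%E) ->
  (\int[lebesgue_tuple n.+1]_y f y =
   \int[lebesgue_tuple n]_y \int[lebesgue_measure]_x f (cons_pair (x, y)))%E.
Proof.
move=> mf f0.
have mc : measurable_fun [set: T * n.-tuple T] (@cons_pair R n).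
  exact: measurable_cons.
rewrite [lebesgue_tuple n.+1]/=.
rewrite (@ge0_integral_pushforward _ _ _ _ R (@cons_pair R n) mc
  (product_measure1 lebesgue_measure (lebesgue_tuple n)) setT f)//.
rewrite preimage_setT (@fubini_tonelli2 _ _ _ _ R lebesgue_measure
  (lebesgue_tuple n) (f \o @cons_pair R n))//.
  exact: measurableT_comp.
by move=> z; exact: f0.
Qed.

Lemma integral_gaussian_tuple n (M : 'M[R]_n) (w : 'cV[R]_n) :
  M^T = M -> posdefmx M ->
  (\int[lebesgue_tuple n]_y (gaussian M w y)%:E =
   ((4 * pi) `^ (n%:R / 2) * (Num.sqrt (\det M))^-1)%:E)%E.
Proof.
elim: n M w => [|n IHn] M w symM posM.
  (* In dimension zero the measure is the Dirac mass at the empty tuple, and the empty determinant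
     is one. *)
  rewrite [LHS]integral_dirac//=; last first.
    by apply/measurable_EFinP; exact: measurable_gaussian.
  rewrite diracT mul1e mul0r powRr0 det_mx00 sqrtr1 invr1 mulr1 /gaussian.
  by rewrite /dotcv big_ord0 mul0r oppr0 expR0.
have a0 : 0 < M 0 0 := schur_pivot_gt0 (M := M : 'M[R]_(1 + n)) symM posM.
set S : 'M[R]_n := schur (M : 'M[R]_(1 + n)).
set w' := dsubmx (w : 'cV[R]_(1 + n)).
have c0 : 0 <= (4 * pi) `^ (1 / 2) * (Num.sqrt (M 0 0))^-1 :> R.
  by rewrite mulr_ge0 ?powR_ge0 ?invr_ge0 ?sqrtr_ge0.
rewrite integral_lebesgue_tupleS; last 2 first.
- by apply/measurable_EFinP; exact: measurable_gaussian.
- by move=> y; rewrite lee_fin ltW// gaussian_gt0.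
transitivity (\int[lebesgue_tuple n]_y
  (((4 * pi) `^ (1 / 2) * (Num.sqrt (M 0 0))^-1)%:E * (gaussian S w' y)%:E))%E.
  apply: eq_integral => y _.
  (* The centre of this Gaussian in x depends on y, but its integral over x does not. *)
  under eq_integral do rewrite gaussian_cons// EFinM muleC.
  rewrite ge0_integralZl_EFin//; last 2 first.
  - apply/measurable_EFinP; apply: measurableT_comp => //.
    apply: measurableT_comp => //; apply: measurable_funM => //.
    apply: measurable_funM => //; apply: measurable_funX.
    exact: measurable_funB.
  - by rewrite ltW// gaussian_gt0.
  by rewrite integral_gaussian// muleC.
rewrite ge0_integralZl_EFin//; last 2 first.
- by move=> y _; rewrite lee_fin ltW// gaussian_gt0.
- by apply/measurable_EFinP; exact: measurable_gaussian.
rewrite IHn; [|exact: schur_tr|exact: schur_posdef].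
rewrite -EFinM; congr EFin.
rewrite [in RHS](schur_det (M := M : 'M[R]_(1 + n)) symM posM) -/S.
rewrite sqrtrM ?(ltW a0)// invfM mulrACA -powRD; last first.
  by rewrite gt_eqF ?implybT// mulr_gt0 ?pi_gt0.
by congr (_ `^ _ * _); rewrite -natr1; field.
Qed.

End gaussian.

(** * From Borel sets to Lebesgue measurable sets *)

Section lebesgue_euclid.
Context {R : realType} {N : nat}.
Local Notation T := (measurableTypeR R).

Lemma measurable_euclid_tuple :
  measurable_fun [set: euclid R N] (fun X : euclid R N => (X : N.-tuple T)).
Proof.
move=> _ A mA; rewrite setTI;
apply: (@sub_caratheodory _ _ _ (@lebesgue_tuple R N)).
exact: sub_sigma_algebra.
Qed.

(** Borel sets are Caratheodory measurable, and the completed measure agrees with the product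
    measure on them. *)
Lemma integral_lebesgue_euclid (f : N.-tuple T -> \bar R) :
  measurable_fun [set: N.-tuple T] f -> (forall y, (0 <= f y)%E) ->
  (\int[lebesgue_euclid R N]_X f X = \int[lebesgue_tuple N]_y f y)%E.
Proof.
move=> mf f0.
rewrite -[LHS](@ge0_integral_pushforward _ _ _ _ R _ measurable_euclid_tuple
  (lebesgue_euclid R N) setT f)//.
apply: eq_measure_integral => [|? A mA _]; first exact: measurable_euclid_tuple.
exact: (@measurable_mu_extE _ R _ (@lebesgue_tuple R N)).
Qed.

End lebesgue_euclid.

(** * The heat kernel *)

Section posdefmx_inv.
Context {R : realType} {n : nat}.
Variable K : 'M[R]_n.
Hypotheses (symK : K^T = K) (posK : posdefmx K).

Lemma posdefmx_unit : K \in unitmx.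
Proof.
rewrite unitmxE unitfE; apply/det0P => -[v v0 vK].
have := posK (x := v^T); rewrite trmx_eq0 => /(_ v0).
by rewrite -{1}symK -trmx_mul vK trmx0 dotcv0l ltxx.
Qed.

(** With x = K y, the form of the inverse at x is the form of K at y. *)
Lemma posdefmx_inv : posdefmx (invmx K).
Proof.
move=> x x0; have uK := posdefmx_unit.
rewrite -{2}(mulKVmx uK x) dotcvC; apply: posK.
apply: contra x0 => /eqP Kx0.
by rewrite -(mulKVmx uK x) Kx0 mulmx0.
Qed.

End posdefmx_inv.

Section heat_kernel.
Context {R : realType} {N : nat}.
Variables (Q B : 'M[R]_N) (D gammaD : R).
Hypotheses (symQ : Q^T = Q) (gamma0 : 0 < gammaD).
Hypothesis posK : forall t : R, 0 < t -> posdefmx (covmx Q B t).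
Hypothesis volD :
  forall t : R, 0 < t -> gammaD * t `^ (D / 2) <= volume Q B t.

Let M t := t^-1 *: invmx (covmx Q B t).

Lemma heat_kernelE (t : R) (X Y : euclid R N) : 0 < t ->
  heat_kernel Q B X Y t =
  unit_ball_volume R N * (4 * pi) `^ (- (N%:R / 2)) / volume Q B t *
  gaussian (M t) (expmx (t *: B) *m colvec X) Y.
Proof.
move=> t0; rewrite /heat_kernel; congr (_ * _).
rewrite /gaussian /pseudodist -/(colvec Y); congr expR.
set Z := colvec Y - _.
(* Squaring undoes the root only if the form is nonnegative; positive definiteness says so for
   nonzero vectors, whence the separate case. *)
rewrite sqr_sqrtr; last first.
  have [->|Z0] := eqVneq Z 0; first by rewrite mulmx0 dotcv0l.
  by apply/ltW/posdefmx_inv => //; [exact: covmx_tr|exact: posK].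
rewrite /M -scalemxAl dotcvZl; field; exact: lt0r_neq0.
Qed.

Lemma heat_kernel_ge0 (t : R) (X Y : euclid R N) : 0 <= heat_kernel Q B X Y t.
Proof.
have ball0 : 0 <= unit_ball_volume R N by exact: fine_ge0.
by rewrite mulr_ge0 ?expR_ge0// mulr_ge0 ?invr_ge0 ?mulr_ge0 ?powR_ge0.
Qed.

Lemma measurable_heat_kernel (t : R) (X : euclid R N) : 0 < t ->
  measurable_fun [set: euclid R N] (fun Y => heat_kernel Q B X Y t).
Proof.
move=> t0; under eq_fun do rewrite heat_kernelE//.
apply: measurable_funM => //.
exact: (measurableT_comp (measurable_gaussian _ _) measurable_euclid_tuple).
Qed.

Let volume_gt0 (t : R) : 0 < t -> 0 < volume Q B t.
Proof. by move=> t0; rewrite (lt_le_trans _ (volD t0))// mulr_gt0// powR_gt0. Qed.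

Lemma integral_heat_kernel (t : R) (X : euclid R N) : 0 < t ->
  (\int[lebesgue_euclid R N]_Y (heat_kernel Q B X Y t)%:E = 1)%E.
Proof.
move=> t0; have := volume_gt0 t0; rewrite /volume => vol0.
(* Positivity of V(t), granted by the lower bound, gives a positive determinant and a nonzero ball
   volume without computing either. *)
have det_gt0 : 0 < \det (t *: covmx Q B t).
  by rewrite -sqrtr_gt0 lt_neqAle sqrtr_ge0 eq_sym andbT;
    apply: contraTN vol0 => /eqP ->; rewrite mulr0 ltxx.
have ball0 : unit_ball_volume R N != 0.
  by apply: contraTN vol0 => /eqP ->; rewrite mul0r ltxx.
have symK := covmx_tr B t symQ.
have uK := posdefmx_unit symK (posK t0).
have c0 : 0 <= unit_ball_volume R N * (4 * pi) `^ (- (N%:R / 2)) / volume Q B t.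
  rewrite divr_ge0 ?(ltW (volume_gt0 t0))// mulr_ge0 ?powR_ge0//.
  exact: fine_ge0.
under eq_integral do rewrite heat_kernelE// EFinM.
rewrite (integral_lebesgue_euclid
  (f := fun y => (_ * (gaussian _ _ y)%:E)%E)); last 2 first.
- apply: measurable_funeM; apply/measurable_EFinP; exact: measurable_gaussian.
- by move=> y; rewrite -EFinM lee_fin mulr_ge0// ltW// gaussian_gt0.
rewrite ge0_integralZl_EFin//; last 2 first.
- by move=> y _; rewrite lee_fin (ltW (gaussian_gt0 _ _ _)).
- by apply/measurable_EFinP; exact: measurable_gaussian.
rewrite integral_gaussian_tuple; first last.
- move=> x x0; rewrite /M -scalemxAl dotcvZl mulr_gt0 ?invr_gt0//.
  by apply: posdefmx_inv => //; exact: posK.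
- by rewrite /M linearZ/= trmx_inv symK.
have -> : \det (M t) = (\det (t *: covmx Q B t))^-1.
  by rewrite /M detZ det_inv [in RHS]detZ invfM exprVn.
rewrite -EFinM sqrtrV ?(ltW det_gt0)// invrK powRN /volume; congr EFin.
by field; rewrite ball0 !gt_eqF ?sqrtr_gt0 ?powR_gt0// mulr_gt0 ?pi_gt0.
Qed.

(** The exponential is at most one and the volume is bounded below; the summand 1 serves to make the
    constant positive. *)
Lemma heat_kernel_le (t : R) (X Y : euclid R N) : 0 < t ->
  heat_kernel Q B X Y t <=
  (unit_ball_volume R N * (4 * pi) `^ (- (N%:R / 2)) / gammaD + 1)
  * t `^ (- (D / 2)).
Proof.
move=> t0; have ball0 : 0 <= unit_ball_volume R N by exact: fine_ge0.
set A := unit_ball_volume R N * (4 * pi) `^ (- (N%:R / 2)).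
have A0 : 0 <= A by rewrite mulr_ge0 ?powR_ge0.
have tD : 0 < t `^ (D / 2) by rewrite powR_gt0.
apply: (@le_trans _ _ (A / volume Q B t)).
  rewrite /heat_kernel ler_piMr ?divr_ge0 ?(ltW (volume_gt0 t0))//.
  by rewrite -expR0 ler_expR oppr_le0 divr_ge0 ?sqr_ge0 ?mulr_ge0 ?ltW.
apply: (@le_trans _ _ (A / gammaD * t `^ (- (D / 2)))); last first.
  by rewrite ler_wpM2r ?powR_ge0//; lra.
rewrite powRN -mulrA -invfM ler_wpM2l// lef_pV2 ?posrE ?volume_gt0 ?mulr_gt0//.
exact: volD.
Qed.

Lemma besov_seminormE (s : R) (f : euclid R N -> R) :
  besov_seminorm Q B (2 * s) 1 f =
  (\int[lebesgue_measure]_(t in `]0%R, +oo[) ((t `^ (s + 1))^-1%:E *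
     \int[lebesgue_euclid R N]_X \int[lebesgue_euclid R N]_Y
       (heat_kernel Q B X Y t * `|f Y - f X|)%:E))%E.
Proof.
rewrite /besov_seminorm invr1 poweRe1; last first.
  apply: integral_ge0 => t _; rewrite mule_ge0 ?lee_fin ?invr_ge0 ?powR_ge0//.
  apply: integral_ge0 => X _; apply: integral_ge0 => Y _.
  by rewrite lee_fin mulr_ge0 ?powR_ge0// heat_kernel_ge0.
have -> : 2 * s * 1 / 2 + 1 = s + 1 by field.
apply: eq_integral => t _; congr (_ * _)%E; apply: eq_integral => X _.
by apply: eq_integral => Y _; rewrite powRr1.
Qed.

End heat_kernel.

(** * The Sobolev embedding and the isoperimetric inequality *)

Lemma Lnorm_indic d (T : measurableType d) (R : realType)
    (mu : {measure set T -> \bar R}) (E : set T) (q : R) :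
  measurable E -> q != 0 -> (Lnorm mu q%:E (EFin \o \1_E) = mu E `^ q^-1)%E.
Proof.
move=> mE q0; rewrite unlock; congr (_ `^ _)%E.
rewrite -[E in RHS]setIT -integral_indic//; apply: eq_integral => x _ /=.
by rewrite indicE; case: (_ \in _); rewrite ?normr1 ?normr0 ?powR1 ?powR0.
Qed.

Unset Implicit Arguments.
Set Strict Implicit.

Theorem theorem1p3 (R : realType) (N : nat) (D s gammaD : R) :
  (2 <= N)%N -> 0 < s -> s < 1 / 2 -> 0 < D -> 0 < gammaD ->
  exists c : R, 0 < c /\
    forall Q B : 'M[R]_N,
      Q^T = Q -> possemidefmx Q ->
      (forall t : R, 0 < t -> posdefmx (covmx Q B t)) ->
      0 <= \tr B ->
      (forall t : R, 0 < t -> gammaD * t `^ (D / 2) <= volume Q B t) ->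
      [/\ besov_space Q B (2 * s) 1 `<=`
            [set f | f \in Lfun (lebesgue_euclid R N) (D / (D - 2 * s))%:E],
          (forall f : euclid R N -> R, besov_space Q B (2 * s) 1 f ->
            (Lnorm (lebesgue_euclid R N) (D / (D - 2 * s))%:E (EFin \o f)
              <= (1 / c)%:E * besov_seminorm Q B (2 * s) 1 f)%E)
        & (forall E : set (euclid R N), measurable E ->
            (lebesgue_euclid R N E < +oo)%E ->
            (c%:E * lebesgue_euclid R N E `^ ((D - 2 * s) / D)
              <= sperimeter Q B s E)%E)].
Proof.
move=> N2 s0 s2 D0 gamma0.
(* The constant is fixed before Q and B and involves only N and [gammaD]. The added 1 gives C > 0
   from the mere nonnegativity of the ball volume. *)
pose C : R := unit_ball_volume R N * (4 * pi) `^ (- (N%:R / 2)) / gammaD + 1.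
have C0 : 0 < C.
  rewrite ltr_wpDl// divr_ge0 ?(ltW gamma0)// mulr_ge0 ?powR_ge0//.
  exact: fine_ge0.
pose c := sobolev_cst C D s; have c0 : 0 < c by exact: sobolev_cst_gt0.
exists c; split=> // Q B symQ _ posK _ volD.
have sD : 2 * s < D by exact: volume_exponent_gt N2 s2 gamma0 volD.
(* Stated for integrable f whose seminorm may be infinite, so that the indicator of a set of finite
   measure is covered whatever its perimeter. *)
have main (f : euclid R N -> R) : measurable_fun [set: euclid R N] f ->
    (\int[lebesgue_euclid R N]_X `|f X|%:E < +oo)%E ->
    (c%:E * Lnorm (lebesgue_euclid R N) (D / (D - 2 * s))%:E (EFin \o f) <=
     besov_seminorm Q B (2 * s) 1 f)%E.
  move=> mf f1; rewrite besov_seminormE.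
  apply: (@sobolev_inequality _ _ R (lebesgue_euclid R N)
    (fun t X Y => heat_kernel Q B X Y t) C D s s0 sD C0 _ _ _ _ f mf f1).
  - by move=> t X Y _; exact: heat_kernel_ge0.
  - by move=> t X t0; exact: measurable_heat_kernel.
  - by move=> t X t0; exact: integral_heat_kernel volD _ _ t0.
  - by move=> t X Y t0; exact: heat_kernel_le.
have Lfun1P (f : euclid R N -> R) : besov_space Q B (2 * s) 1 f ->
    measurable_fun [set: euclid R N] f /\
    (\int[lebesgue_euclid R N]_X `|f X|%:E < +oo)%E.
  move=> [/andP[/set_mem mf /set_mem f1] _]; split=> //.
  by move: f1; rewrite /= /finite_norm Lnorm1.
have bound (f : euclid R N -> R) : besov_space Q B (2 * s) 1 f ->
    (Lnorm (lebesgue_euclid R N) (D / (D - 2 * s))%:E (EFin \o f) <=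
     (1 / c)%:E * besov_seminorm Q B (2 * s) 1 f)%E.
  by move=> /Lfun1P[mf f1]; rewrite div1r lee_pdivlMl// main.
split=> // [f Bf|E mE Efin].
  have [mf _] := Lfun1P _ Bf; apply/andP; split; apply/mem_set => //=.
  rewrite /finite_norm (le_lt_trans (bound _ Bf))// lte_mul_pinfty//.
    by rewrite lee_fin divr_ge0// ltW.
  by case: Bf.
have q0 : D / (D - 2 * s) != 0 by rewrite gt_eqF// divr_gt0// subr_gt0.
rewrite -invf_div -Lnorm_indic//; apply: main; first exact: measurable_indic.
rewrite (eq_integral (fun X => (\1_E X)%:E)) ?integral_indic ?setIT//.
by move=> X _; rewrite ger0_norm.
Qed.
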